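(* Let $\phi\colon\Lambda_1\to\Lambda_2$ be a homomorphism of lattices, and for $i=1,2$ let $(K_{f_i},A_{g_i})$ be a Riemann–Roch pair on $\Lambda_i$ with Todd class $\mathrm{td}_i$ and Chern character $\mathrm{ch}\colon\mathbb{Q}K_{f_i}\to\mathbb{Q}A_{g_i}$. If $\phi_*(\mathrm{Ann}_{\mathrm{Sh}}(f_1))\subseteq\mathrm{Ann}_{\mathrm{Sh}}(f_2)$, then the diagram formed by the pullbacks $\phi^*\colon\mathbb{Q}K_{f_2}\to\mathbb{Q}K_{f_1}$ and $\phi^*\colon\mathbb{Q}A_{g_2}\to\mathbb{Q}A_{g_1}$ and the vertical maps $\mathrm{td}_i\cdot\mathrm{ch}(-)$ commutes, i.e. $$\phi^*\big(\mathrm{td}_2\cdot\mathrm{ch}(\xi)\big)=\mathrm{td}_1\cdot\mathrm{ch}(\phi^*\xi)\qquad\text{for all }\xi\in\mathbb{Q}K_{f_2}.$$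
   Context: A lattice $\Lambda$ is a free abelian group of finite rank; $P(\Lambda)$ is the ring of polynomial functions $\Lambda\to\mathbb{Q}$ with rational coefficients. $\mathrm{Sh}(\Lambda)=\mathbb{Z}[\Lambda]$ is the group ring with basis $T^u$, acting on functions by $(T^uh)(x)=h(x+u)$. $\mathrm{Diff}(\Lambda)$ is the ring of differential operators with constant integer coefficients acting on $P(\Lambda)$; $\partial_u$ is the directional derivative along $u$. $\mathbb{Q}R=\mathbb{Q}\otimes_{\mathbb{Z}}R$; $\mathrm{Sh}_{\mathbb{Q}}=\mathbb{Q}\,\mathrm{Sh}$, $\mathrm{Diff}_{\mathbb{Q}}=\mathbb{Q}\,\mathrm{Diff}$. $K_f=\mathrm{Sh}(\Lambda)/\mathrm{Ann}_{\mathrm{Sh}}(f)$, $A_g=\mathrm{Diff}(\Lambda)/\mathrm{Ann}_{\mathrm{Diff}}(g)$ ($\mathrm{Ann}$: ideal of operators killing the polynomial); $\mathbb{Q}K_f$ and $\mathbb{Q}A_g$ act on $f$, resp. $g$. $(K_f,A_g)$ is a Riemann–Roch pair if $f,g\in P(\Lambda)$, $g$ is homogeneous, and there is a unit $\mathrm{td}\in(\mathbb{Q}A_g)^\times$ (the Todd class) with $f=\mathrm{td}\cdot g$; in that case there is a ring isomorphism $\mathrm{ch}\colon\mathbb{Q}K_f\to\mathbb{Q}A_g$, $[T^u]\mapsto\exp([\partial_u])$. The homomorphism $\phi$ induces the pullback of functions $\phi^*\colon P(\Lambda_2)\to P(\Lambda_1)$, $h\mapsto h\circ\phi$, and the ring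 homomorphism $\phi_*\colon\mathrm{Sh}(\Lambda_1)\to\mathrm{Sh}(\Lambda_2)$, $T^u\mapsto T^{\phi(u)}$. The condition $\phi_*(\mathrm{Ann}_{\mathrm{Sh}}(f_1))\subseteq\mathrm{Ann}_{\mathrm{Sh}}(f_2)$ is equivalent to $\phi^*(\mathrm{Sh}_{\mathbb{Q}}(\Lambda_2)\cdot f_2)\subseteq\mathrm{Sh}_{\mathbb{Q}}(\Lambda_1)\cdot f_1$ and to $\phi^*(\mathrm{Diff}_{\mathbb{Q}}(\Lambda_2)\cdot g_2)\subseteq\mathrm{Diff}_{\mathbb{Q}}(\Lambda_1)\cdot g_1$. Under it, the $\mathbb{Q}$-linear pullback $\phi^*\colon\mathbb{Q}K_{f_2}\to\mathbb{Q}K_{f_1}$ is defined by $(\phi^*\xi)\cdot f_1=\phi^*(\xi\cdot f_2)$, via the isomorphisms $\mathbb{Q}K_{f_i}\cong\mathrm{Sh}_{\mathbb{Q}}(\Lambda_i)\cdot f_i$, $\xi\mapsto\xi\cdot f_i$; similarly $\phi^*\colon\mathbb{Q}A_{g_2}\to\mathbb{Q}A_{g_1}$ is defined by $(\phi^*\alpha)\cdot g_1=\phi^*(\alpha\cdot g_2)$. *)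

(* Defs.v *)
From HB Require Import structures.
From Stdlib Require Import ClassicalEpsilon.
From mathcomp Require Import all_boot all_order all_algebra.
From mathcomp Require Import ring lra.
From mathcomp.multinomials Require Import freeg mpoly.

Set Implicit Arguments.
Unset Strict Implicit.
Unset Printing Implicit Defensive.

Import GRing.Theory Num.Theory.
Local Open Scope ring_scope.

(* Two different algebras act on the same space of polynomial functions, so
   the module structures are explicit records, not canonical instances. *)
Record action (R : comAlgType rat) (V : lmodType rat) := Action {
  act :> R -> V -> V;
  act_linl : forall v, linear (act^~ v);
  act_linr : forall a, linear (act a);
  act1 : forall v, act 1 v = v;
  actM : forall a b v, act (a * b) v = act a (act b v)
}.

Section Cyclic.
Variables (R : comAlgType rat) (V : lmodType rat).
Variables (A : action R V) (v : V).

Definition orb (a : R) : V := A a v.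
HB.instance Definition _ := GRing.isLinear.Build rat R V _ orb (act_linl A v).

Lemma act0l : A 0 v = 0.
Proof. by rewrite -[LHS]/(orb _) raddf0. Qed.

Lemma act0r a : A a 0 = 0.
Proof. by have := act_linr A a (-1) 0 0; rewrite !scaleN1r oppr0 addr0 addNr. Qed.

Lemma actZl q a : A (q *: a) v = q *: A a v.
Proof. by rewrite -[LHS]/(orb _) linearZ. Qed.

Lemma act_suml (I : Type) (r : seq I) (P : pred I) (a : I -> R) :
  A (\sum_(i <- r | P i) a i) v = \sum_(i <- r | P i) A (a i) v.
Proof. by rewrite -[LHS]/(orb _) raddf_sum. Qed.

Definition ann : {pred R} := fun a => A a v == 0.

Lemma ann_zmod_closed : zmod_closed ann.
Proof.
split=> [|a b]; rewrite !unfold_in /ann -!/(orb _); first by rewrite raddf0.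
by move=> /eqP a0 /eqP b0; rewrite raddfB /= a0 b0 subr0.
Qed.
HB.instance Definition _ := GRing.isZmodClosed.Build R ann ann_zmod_closed.

(* The library only makes [{ideal_quot I}] a ring for a proper ideal; here v
   may be 0, so the (possibly zero) quotient ring is built by hand. *)
Definition cyc : Type := Quotient.quot ann.
HB.instance Definition _ := GRing.Zmodule.on cyc.
Definition cls (a : R) : cyc := \pi_(Quotient.quot ann)%qT a.
Definition rep (x : cyc) : R := repr (x : Quotient.quot ann).

Lemma repK x : cls (rep x) = x. Proof. exact: reprK. Qed.

Lemma clsP a b : reflect (A a v = A b v) (cls a == cls b).
Proof.
rewrite /cls -Quotient.idealrBE unfold_in /ann -/(orb (a - b)) raddfB subr_eq0.
exact: eqP.
Qed.

Lemma cls_eq a b : A a v = A b v -> cls a = cls b.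
Proof. by move=> e; apply/eqP/clsP. Qed.

Lemma rep_cls a : A (rep (cls a)) v = A a v.
Proof. by apply/clsP; rewrite repK. Qed.

Lemma cls_is_zmod_morphism : zmod_morphism cls.
Proof. by move=> a b; rewrite /cls raddfB. Qed.
HB.instance Definition _ := GRing.isZmodMorphism.Build R cyc cls cls_is_zmod_morphism.

Definition cyc_mul (x y : cyc) := cls (rep x * rep y).

Lemma cls_mul a b : cls (a * b) = cyc_mul (cls a) (cls b).
Proof.
by apply: cls_eq; rewrite [RHS]actM rep_cls -[RHS]actM [in RHS]mulrC
  [RHS]actM rep_cls mulrC actM.
Qed.

Lemma cyc_mulA : associative cyc_mul.
Proof. by move=> x y z; rewrite -[x]repK -[y]repK -[z]repK -!cls_mul mulrA. Qed.

Lemma cyc_mulC : commutative cyc_mul.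
Proof. by move=> x y; rewrite -[x]repK -[y]repK -!cls_mul mulrC. Qed.

Lemma cyc_mul1 : left_id (cls 1) cyc_mul.
Proof. by move=> x; rewrite -[x]repK -!cls_mul mul1r. Qed.

Lemma cyc_mulD : left_distributive cyc_mul +%R.
Proof.
move=> x y z; rewrite -[x]repK -[y]repK -[z]repK -raddfD -!cls_mul -raddfD.
by rewrite mulrDl.
Qed.

HB.instance Definition _ := GRing.Zmodule_isComPzRing.Build cyc
  cyc_mulA cyc_mulC cyc_mul1 cyc_mulD.

Lemma cls_is_monoid_morphism : monoid_morphism cls.
Proof. by split=> [|a b]; rewrite ?cls_mul. Qed.
HB.instance Definition _ :=
  GRing.isMonoidMorphism.Build R cyc cls cls_is_monoid_morphism.

Definition cyc_scale (q : rat) (x : cyc) := cls (q *: rep x).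

Lemma cls_scale q a : cls (q *: a) = cyc_scale q (cls a).
Proof.
apply: cls_eq; rewrite -/(orb (q *: a)) -/(orb (q *: rep (cls a))) !linearZ.
by rewrite /= /orb rep_cls.
Qed.

Lemma cyc_scaleA q r x : cyc_scale q (cyc_scale r x) = cyc_scale (q * r) x.
Proof. by rewrite -[x]repK -!cls_scale scalerA. Qed.

Lemma cyc_scale1 : left_id 1 cyc_scale.
Proof. by move=> x; rewrite -[x]repK -!cls_scale scale1r. Qed.

Lemma cyc_scaleDr : right_distributive cyc_scale +%R.
Proof.
move=> q x y.
by rewrite -[x]repK -[y]repK -raddfD -!cls_scale -raddfD scalerDr.
Qed.

Lemma cyc_scaleDl x : {morph cyc_scale^~ x : q r / q + r}.
Proof. by move=> q r; rewrite -[x]repK -!cls_scale -raddfD scalerDl. Qed.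

HB.instance Definition _ := GRing.Zmodule_isLmodule.Build rat cyc
  cyc_scaleA cyc_scale1 cyc_scaleDr cyc_scaleDl.

Lemma cls_is_scalable : scalable cls.
Proof. exact: cls_scale. Qed.
HB.instance Definition _ := GRing.isScalable.Build rat R cyc _ cls cls_is_scalable.

Definition cact (x : cyc) : V := A (rep x) v.

Lemma cact_cls a : cact (cls a) = A a v. Proof. exact: rep_cls. Qed.

Lemma cyc_scaleAl (q : rat) (x y : cyc) : q *: x * y = q *: (x * y).
Proof. by rewrite -[x]repK -[y]repK -linearZ -!rmorphM -linearZ scalerAl. Qed.

Lemma cact_linear : linear cact.
Proof.
move=> q x y; rewrite -[x]repK -[y]repK -linearZ -raddfD !cact_cls.
exact: (act_linl A v).
Qed.
HB.instance Definition _ := GRing.isLinear.Build rat cyc V _ cact cact_linear.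

Lemma cact_inj : injective cact.
Proof. by move=> x y e; rewrite -[x]repK -[y]repK; apply: cls_eq. Qed.

Definition cyc_unit (x : cyc) : Prop := exists y, x * y = 1.

(* The partial sums of the exponential series are eventually constant when x
   is nilpotent; [nexp x] is their eventual value. *)
Definition nexp (x : cyc) : cyc :=
  epsilon (inhabits 0) (fun e => exists N, forall M, (N <= M)%N ->
    e = \sum_(k < M) (k`!%:R)^-1 *: x ^+ k).

Lemma nexpE x N : x ^+ N = 0 -> nexp x = \sum_(k < N) (k`!%:R)^-1 *: x ^+ k.
Proof.
move=> xN0; rewrite /nexp; set P := fun e => _.
have: exists e, P e.
  exists (\sum_(k < N) (k`!%:R)^-1 *: x ^+ k), N => M leNM.
  rewrite -!(big_mkord xpredT (fun k => (k`!%:R)^-1 *: x ^+ k)).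
  rewrite (big_cat_nat _ leNM) //=.
  rewrite [X in _ = _ + X]big_nat [X in _ = _ + X]big1 ?addr0 // => k /andP[leNk _].
  by rewrite -(subnKC leNk) exprD xN0 mul0r scaler0.
move=> /(epsilon_spec (inhabits 0)) [M eM].
rewrite (eM (maxn M N)) ?leq_maxl //.
rewrite -!(big_mkord xpredT (fun k => (k`!%:R)^-1 *: x ^+ k)).
rewrite (big_cat_nat _ (leq_maxr M N)) //=.
rewrite [X in _ + X]big_nat [X in _ + X]big1 ?addr0 // => k /andP[leNk _].
by rewrite -(subnKC leNk) exprD xN0 mul0r scaler0.
Qed.
End Cyclic.

Section LinearExtension.
Variables (R : comNzRingType) (K : choiceType).

Lemma fglift_is_linear (M : lmodType R) (f : K -> M) :
  linear (fglift f : {freeg K / R} -> M).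
Proof.
move=> c; have fgB := @lift_is_additive R K M f.
have fg0 : fglift f 0 = 0 by have := fgB 0 0; rewrite !subrr.
have fgN D : fglift f (- D) = - fglift f D.
  by have := fgB 0 D; rewrite fg0 !sub0r.
have fgD D E : fglift f (D + E) = fglift f D + fglift f E.
  by rewrite -{1}[E]opprK fgB fgN opprK.
move=> D E; rewrite fgD; congr (_ + _).
elim/freeg_ind_dom0: D => [|k x D _ _ IH]; first by rewrite scaler0 fg0 scaler0.
rewrite scalerDr !fgD scalerDr IH; congr (_ + _).
have -> : c *: << k *g x >> = << c * k *g x >> :> {freeg K / R}.
  by apply/eqP/freeg_eqP=> y; rewrite coeffZ !coeffU mulrA.
by rewrite !liftU scalerA.
Qed.

HB.instance Definition _ (M : lmodType R) (f : K -> M) :=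
  GRing.isLinear.Build R {freeg K / R} M _ (fglift f) (fglift_is_linear f).

Lemma freegUE k x : << k *g x >> = k *: << x >> :> {freeg K / R}.
Proof. by apply/eqP/freeg_eqP=> y; rewrite coeffZ !coeffU mul1r. Qed.

Lemma eq_freeg_linear (M : lmodType R) (f g : {linear {freeg K / R} -> M}) :
  (forall x, f << x >> = g << x >>) -> f =1 g.
Proof.
move=> e; elim/freeg_ind_dom0=> [|k x D _ _ IH]; first by rewrite !raddf0.
by rewrite !raddfD /= IH freegUE !linearZ /= e.
Qed.
End LinearExtension.

(* Z[L] (R := int) and Q[L] (R := rat); the basis element T^u is << u >>. *)
Definition Sh (R : comNzRingType) (L : zmodType) : Type := {freeg L / R}.
HB.instance Definition _ R L := GRing.Lmodule.on (Sh R L).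

Section GroupRing.
Variables (R : comNzRingType) (L : zmodType).
Implicit Types a b c : Sh R L.

Definition sh_mulT (u : L) b : Sh R L := fglift (fun w => << u + w >> : Sh R L) b.
HB.instance Definition _ u := GRing.Linear.copy (sh_mulT u)
  (fglift (fun w => << u + w >> : Sh R L)).
Definition sh_mul a b : Sh R L := fglift (sh_mulT^~ b) a.

Lemma sh_mulTT u w : sh_mulT u << w >> = << u + w >>.
Proof. by rewrite /sh_mulT liftU scale1r. Qed.

Definition sh_mull b a := sh_mul a b.
HB.instance Definition _ b := GRing.Linear.copy (sh_mull b) (fglift (sh_mulT^~ b)).

Lemma sh_mul_linr a : linear (sh_mul a).
Proof.
move=> k b c; rewrite -!/(sh_mull _ a).
elim/freeg_ind_dom0: a => [|q x D _ _ IH]; first by rewrite !raddf0 addr0.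
rewrite !raddfD /= IH /sh_mull /sh_mul !liftU linearP /=.
by rewrite !scalerDr !scalerA addrACA (mulrC q).
Qed.
HB.instance Definition _ a :=
  GRing.isLinear.Build R (Sh R L) (Sh R L) _ (sh_mul a) (sh_mul_linr a).

Lemma sh_mulTU u w : sh_mul << u >> << w >> = << u + w >>.
Proof. by rewrite /sh_mul liftU scale1r sh_mulTT. Qed.

Lemma sh_mulC : commutative sh_mul.
Proof.
move=> a b; rewrite -[RHS]/(sh_mull a b).
apply: (eq_freeg_linear (f := sh_mul a) (g := sh_mull a)) => w.
rewrite /= -[LHS]/(sh_mull << w >> a) /sh_mull.
apply: (eq_freeg_linear (f := sh_mull << w >>) (g := sh_mul << w >>)) => u.
by rewrite /= /sh_mull !sh_mulTU addrC.
Qed.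

Lemma sh_mulA : associative sh_mul.
Proof.
move=> a b c.
apply: (eq_freeg_linear (f := sh_mul a \o sh_mul b) (g := sh_mul (sh_mul a b))) => w /=.
rewrite !(sh_mulC _ << w >>).
apply: (eq_freeg_linear (f := sh_mul a \o sh_mul << w >>)
                        (g := sh_mul << w >> \o sh_mul a)) => v /=.
rewrite !sh_mulTU !(sh_mulC a).
apply: (eq_freeg_linear (f := sh_mul << w + v >>)
                        (g := sh_mul << w >> \o sh_mul << v >>)) => u /=.
by rewrite !sh_mulTU addrA.
Qed.

Lemma sh_mul1 : left_id (<< 0 >> : Sh R L) sh_mul.
Proof.
move=> a; apply: (eq_freeg_linear (f := sh_mul << 0 >>) (g := idfun)) => w /=.
by rewrite sh_mulTU add0r.
Qed.

Lemma sh_mulDl : left_distributive sh_mul +%R.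
Proof. by move=> a b c; rewrite -!/(sh_mull _ _) raddfD. Qed.

Lemma sh_1neq0 : (<< 0 >> : Sh R L) != 0.
Proof.
apply/eqP=> /(congr1 (coeff 0)); rewrite coeffU eqxx mulr1 coeff0.
by apply/eqP/oner_neq0.
Qed.

HB.instance Definition _ := GRing.Zmodule_isComNzRing.Build (Sh R L)
  sh_mulA sh_mulC sh_mul1 sh_mulDl sh_1neq0.

Lemma sh_scaleAl (k : R) a b : k *: (a * b) = (k *: a) * b.
Proof. by rewrite -[a * b]/(sh_mull b a) -linearZ. Qed.
HB.instance Definition _ := GRing.Lmodule_isLalgebra.Build R (Sh R L) sh_scaleAl.
HB.instance Definition _ := GRing.Lalgebra_isComAlgebra.Build R (Sh R L).

Lemma sh_mulE u w : (<< u >> : Sh R L) * << w >> = << u + w >>.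
Proof. exact: sh_mulTU. Qed.
End GroupRing.

(* A free abelian group of finite rank, together with a Z-basis: [lcoord]
   and [lvec] are the coordinate isomorphism and its inverse. *)
Record lattice := Lattice {
  lcar :> zmodType;
  lrank : nat;
  lcoord : {additive lcar -> 'rV[int]_lrank};
  lvec : 'rV[int]_lrank -> lcar;
  lcoordK : cancel lcoord lvec;
  lvecK : cancel lvec lcoord
}.

Definition qcoord (L : lattice) (u : L) (i : 'I_(lrank L)) : rat :=
  (lcoord L u 0 i)%:~R.

Lemma qcoordD (L : lattice) (u w : L) i : qcoord (u + w) i = qcoord u i + qcoord w i.
Proof. by rewrite /qcoord raddfD mxE rmorphD. Qed.

(* Polynomial functions L -> Q, written in the coordinates of the basis; the
   function itself is [peval h] ([peval_inj], [peval_shift], [peval_pull]). *)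
Definition Pol (L : lattice) : Type := {mpoly rat[lrank L]}.
HB.instance Definition _ L := GRing.ComAlgebra.on (Pol L).

Definition peval (L : lattice) (h : Pol L) (x : L) : rat := h.@[qcoord x].

(* Diff_Q(L) = Q[d_1, ..., d_n], where the variable 'X_i stands for the partial
   derivative d_i along the i-th basis vector. *)
Definition DiffQ (L : lattice) : Type := {mpoly rat[lrank L]}.
HB.instance Definition _ L := GRing.ComAlgebra.on (DiffQ L).

Lemma meval_int_eq0 n (p : {mpoly rat[n]}) :
  (forall v : 'I_n -> int, p.@[fun i => (v i)%:~R] = 0) -> p = 0.
Proof.
elim: n p => [|n IHn] p p0.
  by have := p0 (fun=> 0); rewrite (nvar0_mpolyC p) mevalC => ->.
pose ev (v : 'I_n -> int) := meval (fun i => (v i)%:~R : rat).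
have evE v t : (map_poly (ev v) (muni p)).[t%:~R] = 0.
  pose w (i : 'I_n.+1) := if unlift ord_max i is Some j then v j else t.
  rewrite -(p0 w) muniE mevalE rmorph_sum horner_sum /=; apply: eq_bigr => m _.
  rewrite map_polyZ /= map_polyXn hornerZ hornerXn /ev mevalZ mevalX -mulrA.
  rewrite big_ord_recr /= /w unlift_none; congr (_ * (_ * _)).
  apply: eq_bigr => i _; rewrite mnmE.
  have -> : widen_ord (leqnSn n) i = fintype.lift ord_max i.
    by apply/val_inj; rewrite /= /bump leqNgt ltn_ord.
  by rewrite liftK; congr (_ ^+ m _); apply/val_inj; rewrite /= /bump leqNgt ltn_ord.
have muni_p0 : muni p = 0.
  apply/polyP => k; rewrite coef0; apply: IHn => v.
  rewrite -[LHS]/(ev v (muni p)`_k) -[LHS](coef_map (ev v)).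
  suff -> : map_poly (ev v) (muni p) = 0 by rewrite coef0.
  apply/eqP; apply: contraT => q0; set q := map_poly _ _ in q0 *.
  pose s := [seq (i%:R : rat) | i <- iota 0 (size q)].
  have : (size s < size q)%N.
    apply: max_poly_roots => //.
      by apply/allP => _ /mapP[i _ ->]; apply/rootP; rewrite -(evE v i) -pmulrn.
    rewrite map_inj_uniq ?iota_uniq // => i j /eqP.
    by rewrite eqr_nat => /eqP.
  by rewrite size_map size_iota ltnn.
apply/mpolyP => m; rewrite mcoeff0.
have := congr1 (fun q : {poly {mpoly rat[n]}} =>
  q`_(m ord_max)@_[multinom m (widen_ord (leqnSn n) i) | i < n]) muni_p0.
rewrite coef0 mcoeff0 muniE coef_sum raddf_sum /= => <-.
rewrite {1}[p]mpolyE raddf_sum /=; apply: eq_bigr => m' _.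
rewrite coefZ coefXn mulr_natr mcoeffMn !mcoeffZ !mcoeffX -mulrnAr -mulrnA mulnb.
congr (_ * _%:R); congr nat_of_bool; apply/eqP/andP => [-> //|[/eqP/mnmP e /eqP e']].
apply/mnmP => i; case: (unliftP ord_max i) => [j ->|-> //].
have := e j; rewrite !mnmE.
suff -> : widen_ord (leqnSn n) j = fintype.lift ord_max j by [].
by apply/val_inj; rewrite /= /bump leqNgt ltn_ord.
Qed.

Lemma peval_inj (L : lattice) (h k : Pol L) : peval h =1 peval k -> h = k.
Proof.
move=> e; apply/eqP; rewrite -subr_eq0; apply/eqP/meval_int_eq0 => v.
have := e (lvec (\row_i v i)); rewrite /peval => /eqP.
rewrite -subr_eq0 -mevalB => /eqP <-; apply: meval_eq => i.
by rewrite /qcoord lvecK mxE.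
Qed.

Section ShiftAction.
Variable L : lattice.
Implicit Types (u w : L) (h : Pol L) (a : Sh rat L).

(* (T^u h)(x) = h(x + u) *)
Definition shift u h : Pol L :=
  h \mPo [tuple 'X_i + (qcoord u i)%:MP | i < lrank L].

Lemma peval_shift u h x : peval (shift u h) x = peval h (x + u).
Proof.
rewrite /peval comp_mpoly_meval; apply: meval_eq => i.
by rewrite tnth_mktuple mevalD mevalXU mevalC qcoordD.
Qed.

HB.instance Definition _ u :=
  GRing.Linear.copy (shift u) (comp_mpoly [tuple 'X_i + (qcoord u i)%:MP | i < lrank L]).

Lemma shiftD u w h : shift (u + w) h = shift u (shift w h).
Proof. by apply: peval_inj => x; rewrite !peval_shift addrA. Qed.

Lemma shift0 h : shift 0 h = h.
Proof. by apply: peval_inj => x; rewrite peval_shift addr0. Qed.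

Definition sh_act_fun a h : Pol L := fglift (shift^~ h) a.

Lemma sh_act_linl h : linear (sh_act_fun^~ h).
Proof. exact: fglift_is_linear. Qed.

Lemma sh_act_linr a : linear (sh_act_fun a).
Proof.
move=> k h h'; elim/freeg_ind_dom0: a => [|q u D _ _ IH].
  by rewrite /sh_act_fun !raddf0 addr0.
rewrite /sh_act_fun !raddfD /= in IH *; rewrite IH !liftU linearP /=.
by rewrite !scalerDr !scalerA addrACA (mulrC q).
Qed.

Lemma sh_act1 h : sh_act_fun 1 h = h.
Proof. by rewrite /sh_act_fun liftU scale1r shift0. Qed.

HB.instance Definition _ a :=
  GRing.isLinear.Build rat (Pol L) (Pol L) _ (sh_act_fun a) (sh_act_linr a).

Lemma sh_actM a b h : sh_act_fun (a * b) h = sh_act_fun a (sh_act_fun b h).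
Proof.
have Dl h' c d : sh_act_fun (c + d) h' = sh_act_fun c h' + sh_act_fun d h'.
  by have := sh_act_linl h' 1 c d; rewrite !scale1r.
have f0 h' : sh_act_fun 0 h' = 0 by rewrite /sh_act_fun raddf0.
have Zl h' q c : sh_act_fun (q *: c) h' = q *: sh_act_fun c h'.
  by have := sh_act_linl h' q c 0; rewrite !addr0 f0 addr0.
have U u h' : sh_act_fun << u >> h' = shift u h' by rewrite /sh_act_fun liftU scale1r.
elim/freeg_ind_dom0: a => [|q u a _ _ IH]; first by rewrite mul0r !f0.
rewrite freegUE mulrDl !Dl IH -scalerAl !Zl; congr (_ *: _ + _).
rewrite U {IH}; elim/freeg_ind_dom0: b => [|r w b _ _ IHb].
  by rewrite mulr0 !f0 raddf0.
rewrite (freegUE r) mulrDr !Dl raddfD [X in _ = _ + X]/= IHb -scalerAr !Zl.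
congr (_ + _); rewrite -[RHS]/(shift u (r *: sh_act_fun << w >> h)) linearZ.
by rewrite !U sh_mulE U /= shiftD.
Qed.

Definition sh_act : action (Sh rat L) (Pol L) :=
  Action sh_act_linl sh_act_linr sh_act1 sh_actM.
End ShiftAction.

Section DiffAction.
Variable L : lattice.
Implicit Types (D E : DiffQ L) (h : Pol L).

Definition diff_act_fun D h : Pol L := \sum_(m <- msupp D) D@_m *: h^`M[m].

Lemma diff_actE k D h : (msize D <= k)%N ->
  diff_act_fun D h = \sum_(m : bmultinom (lrank L) k) D@_m *: h^`M[m].
Proof.
pose I : subFinType _ := bmultinom (lrank L) k.
move=> leDk; rewrite /diff_act_fun (ssrcomplements.big_mksub I) ?msupp_uniq //=.
  by rewrite big_rmcond //= => j /memN_msupp_eq0 ->; rewrite scale0r.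
by move=> x /msize_mdeg_lt /leq_trans; apply.
Qed.

Lemma diff_act_linl h : linear (diff_act_fun^~ h).
Proof.
move=> c D E /=; set k := maxn (msize D) (maxn (msize E) (msize (c *: D + E))).
rewrite !(@diff_actE k) ?leq_max ?leqnn ?orbT // scaler_sumr -big_split /=.
by apply: eq_bigr => m _; rewrite mcoeffD mcoeffZ scalerDl scalerA.
Qed.

Lemma diff_act_linr D : linear (diff_act_fun D).
Proof.
move=> c h h'; rewrite /diff_act_fun scaler_sumr -big_split /=.
by apply: eq_bigr => m _; rewrite linearP /= scalerDr !scalerA mulrC.
Qed.

Lemma diff_actX m h : diff_act_fun 'X_[m] h = h^`M[m].
Proof. by rewrite /diff_act_fun msuppX big_seq1 mcoeffX eqxx scale1r. Qed.

Lemma diff_act1 h : diff_act_fun 1 h = h.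
Proof. by rewrite -mpolyX0 diff_actX mderivm0m. Qed.

Lemma diff_actM D E h : diff_act_fun (D * E) h = diff_act_fun D (diff_act_fun E h).
Proof.
have Dl h' D' E' : diff_act_fun (D' + E') h' = diff_act_fun D' h' + diff_act_fun E' h'.
  by have := diff_act_linl h' 1 D' E'; rewrite !scale1r.
have f0 h' : diff_act_fun 0 h' = 0 by rewrite /diff_act_fun msupp0 big_nil.
have Zl h' c D' : diff_act_fun (c *: D') h' = c *: diff_act_fun D' h'.
  by have := diff_act_linl h' c D' 0; rewrite !addr0 f0 addr0.
elim/mpolyind: D => [|c m D _ _ IH]; first by rewrite mul0r !f0.
rewrite mulrDl !Dl IH -scalerAl !Zl; congr (_ *: _ + _).
rewrite diff_actX {IH}; elim/mpolyind: E => [|d m' E _ _ IHE].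
  by rewrite mulr0 !f0 raddf0.
rewrite mulrDr !Dl raddfD /= IHE -scalerAr !Zl linearZ /= !diff_actX.
by rewrite -mpolyXD diff_actX addmC mderivmDm.
Qed.

Definition diff_act : action (DiffQ L) (Pol L) :=
  Action diff_act_linl diff_act_linr diff_act1 diff_actM.
End DiffAction.

Section Operators.
Variable L : lattice.

Definition dir (u : L) : DiffQ L := \sum_(i < lrank L) qcoord u i *: 'X_i.

Definition sh_rat (a : Sh int L) : Sh rat L :=
  \sum_(u <- dom a) (coeff u a)%:~R *: << u >>.

Definition annSh (f : Pol L) : {pred Sh int L} := fun a => sh_act L (sh_rat a) f == 0.

(* Q (x) (Sh(L)/Ann(f)) and Q (x) (Diff(L)/Ann(g)): by flatness of Q over Z
   these are the quotients of the rational operator rings by the rational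
   annihilators; see [annSh_rat]. *)
Definition QK (f : Pol L) := cyc (sh_act L) f.
Definition QA (g : Pol L) := cyc (diff_act L) g.

Lemma coeff_sh_rat a u : coeff u (sh_rat a) = (coeff u a)%:~R.
Proof.
rewrite /sh_rat -[in RHS](freeg_sumE a) !raddf_sum /=; apply: eq_bigr => w _.
by rewrite coeffZ !coeffU mul1r rmorphM /= rmorph_nat.
Qed.

Lemma sh_ratD a b : sh_rat (a + b) = sh_rat a + sh_rat b.
Proof.
by apply/eqP/freeg_eqP => u; rewrite coeffD !coeff_sh_rat coeffD rmorphD.
Qed.

Lemma sh_ratZ (k : int) a : sh_rat (k *: a) = k%:~R *: sh_rat a.
Proof.
by apply/eqP/freeg_eqP => u; rewrite coeffZ !coeff_sh_rat coeffZ rmorphM.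
Qed.

Lemma sh_rat_denom (a : Sh rat L) :
  exists (m : nat) (b : Sh int L), (0 < m)%N /\ m%:R *: a = sh_rat b.
Proof.
elim/freeg_ind_dom0: a => [|q u a _ _ [m [b [m0 e]]]].
  exists 1%N, 0; split=> //; rewrite scaler0; apply/esym/eqP/freeg_eqP => u.
  by rewrite coeff_sh_rat !coeff0.
have dE : `|denq q|%:R = (denq q)%:~R :> rat by rewrite pmulrn gez0_abs // ltW.
exists (`|denq q| * m)%N, ((numq q * m%:R) *: << u >> + denq q *: b); split.
  by rewrite muln_gt0 m0 absz_gt0 denq_neq0.
rewrite sh_ratD !sh_ratZ -e scalerDr; congr (_ + _).
  apply/eqP/freeg_eqP => w; rewrite !coeffZ coeff_sh_rat !coeffU.
  rewrite natrM !rmorphM /= !rmorph_nat.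
  by rewrite dE numqE mul1r; ring.
by rewrite natrM dE scalerA.
Qed.

Lemma annSh_rat (f : Pol L) (a : Sh rat L) :
  a \in ann (sh_act L) f <->
  exists (m : nat) (b : Sh int L), [/\ (0 < m)%N, b \in annSh f & m%:R *: a = sh_rat b].
Proof.
split=> [/eqP a0|[m [b [m0 /eqP b0 e]]]].
  have [m [b [m0 e]]] := sh_rat_denom a; exists m, b; split=> //.
  by rewrite unfold_in /annSh -e actZl a0 scaler0.
have := actZl (sh_act L) f m%:R a; rewrite e b0 => /esym/eqP; rewrite scaler_eq0 pnatr_eq0.
by rewrite eqn0Ngt m0.
Qed.

(* The rational span of [T^u] |-> exp [d_u], computed on a representative; it
   does not depend on the representative when (f, g) is a Riemann-Roch pair
   ([ch_cls]). *)
Definition ch_op (g : Pol L) (a : Sh rat L) : QA g :=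
  fglift (fun u => nexp (cls (diff_act L) g (dir u))) a.
Definition ch (f g : Pol L) (xi : QK f) : QA g := ch_op g (rep xi).

Definition RR_pair (f g : Pol L) (td : QA g) : Prop :=
  [/\ exists d : nat, g \is d.-homog, cyc_unit td & f = cact td].
End Operators.

Section Pullback.
Variables (L1 L2 : lattice) (phi : {additive L1 -> L2}).

(* h |-> h \o phi *)
Definition pull (h : Pol L2) : Pol L1 :=
  h \mPo [tuple \sum_(j < lrank L1) qcoord (phi (lvec (delta_mx 0 j))) i *: 'X_j
         | i < lrank L2].

Lemma peval_pull h x : peval (pull h) x = peval h (phi x).
Proof.
rewrite /peval comp_mpoly_meval; apply: meval_eq => i; rewrite tnth_mktuple.
rewrite raddf_sum /=; under eq_bigr do rewrite mevalZ mevalXU.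
have xE : x = \sum_j lvec (delta_mx 0 j) *~ lcoord L1 x 0 j.
  rewrite -[LHS]lcoordK -[RHS]lcoordK raddf_sum /=; congr lvec.
  rewrite [LHS]row_sum_delta; apply: eq_bigr => j _.
  by rewrite raddfMz lvecK -scaler_int intz.
rewrite [in RHS]/qcoord {2}xE !raddf_sum summxE rmorph_sum /=.
apply: eq_bigr => j _; rewrite !raddfMz /qcoord.
by rewrite -scaler_int mxE intz rmorphM mulrC.
Qed.

Definition push (a : Sh int L1) : Sh int L2 := fglift (fun u => << phi u >> : Sh int L2) a.

(* The class eta with eta . v1 = phi^*(xi . v2); at most one exists. *)
Definition cyc_pull (R1 R2 : comAlgType rat) (A1 : action R1 (Pol L1))
    (A2 : action R2 (Pol L2)) (v1 : Pol L1) (v2 : Pol L2) (xi : cyc A2 v2) : cyc A1 v1 :=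
  epsilon (inhabits 0) (fun eta => cact eta = pull (cact xi)).

Definition pullK (f1 : Pol L1) (f2 : Pol L2) : QK f2 -> QK f1 := @cyc_pull _ _ _ _ f1 f2.
Definition pullA (g1 : Pol L1) (g2 : Pol L2) : QA g2 -> QA g1 := @cyc_pull _ _ _ _ g1 g2.
End Pullback.

(* Main.v *)
(* In a Riemann-Roch pair, exp(d_u) acts on polynomials as T^u (Taylor), so
   (td . ch(xi)) . g = xi . f: both sides of the diagram, applied to g1, become
   phi^*(xi . f2), provided the classes defining the pullbacks exist.
   For this one needs phi^*(Sh . f2) in Sh . f1. An element h of the left side
   is killed by Ann(f1), and any such h lies in Sh . f1: by Taylor the matrix
   f1(u + w) indexed by u, w in L1 has finite rank, so the linear relations
   among its rows are detected on finitely many entries; h obeys these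
   relations, hence is a finite combination of columns of the matrix, which are
   the translates of f1. *)
Require Import Defs.
From Stdlib Require Import Classical ClassicalEpsilon.
From mathcomp Require Import all_boot all_order all_algebra.
From mathcomp.multinomials Require Import freeg mpoly.

Set Implicit Arguments.
Unset Strict Implicit.

Import GRing.Theory Num.Theory.
Local Open Scope ring_scope.

(** * Elementary rules for actions *)

Section Actions.
Variables (R : comAlgType rat) (V : lmodType rat) (A : action R V).

Lemma actZr (a : R) (q : rat) (v : V) : A a (q *: v) = q *: A a v.
Proof. by have := act_linr A a q v 0; rewrite !addr0 act0r addr0. Qed.

Lemma actC (a b : R) (v : V) : A a (A b v) = A b (A a v).
Proof. by rewrite -!actM mulrC. Qed.

Lemma cact_mul_cls (v : V) (x : cyc A v) (b : R) :
  cact (x * cls A v b) = A b (cact x).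
Proof. by rewrite -{1}[x]repK -rmorphM cact_cls mulrC actM. Qed.
End Actions.

Lemma inv_factSr (K : nat) : K.+1`!%:R^-1 * K.+1%:R = K`!%:R^-1 :> rat.
Proof. by rewrite factS natrM invfM mulrC mulVKf // pnatr_eq0. Qed.

(** * Taylor's formula for truncated exponentials *)

Section Taylor.
Variable L : lattice.
Implicit Types (u : L) (h : Pol L).

Lemma act_dir u h : diff_act L (dir u) h = \sum_i qcoord u i *: h^`M(i).
Proof.
rewrite act_suml; apply: eq_bigr => i _.
by rewrite actZl /= diff_actX mderivmU1m.
Qed.

Lemma act_dirXM u (i : 'I_(lrank L)) h :
  diff_act L (dir u) ('X_i * h) = 'X_i * diff_act L (dir u) h + qcoord u i *: h.
Proof.
rewrite !act_dir mulr_sumr.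
under eq_bigr do rewrite mderivM mderivX mnm1E scalerDr (scalerAr _ 'X_i) addrC.
rewrite big_split /=; congr (_ + _).
rewrite (bigD1 i) //= eqxx scale1r.
have -> : (U_(i) - U_(i) = 0)%MM by apply/mnmP => j; rewrite mnmBE subnn mnm0E.
rewrite mpolyX0 mul1r big1 ?addr0 // => j ji.
by rewrite eq_sym (negPf ji) scale0r mul0r scaler0.
Qed.

(** Iterated Leibniz rule: each of the [k.+1] factors contributes one commutator [qcoord u i]. *)
Lemma act_dir_expXM u (i : 'I_(lrank L)) h k :
  diff_act L (dir u ^+ k.+1) ('X_i * h) =
    'X_i * diff_act L (dir u ^+ k.+1) h +
    (k.+1%:R * qcoord u i) *: diff_act L (dir u ^+ k) h.
Proof.
elim: k => [|k IH]; first by rewrite expr1 act_dirXM expr0 act1 mul1r.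
rewrite exprS actM IH.
have -> a b : diff_act L (dir u) (a + b) = diff_act L (dir u) a + diff_act L (dir u) b.
  by have := act_linr (diff_act L) (dir u) 1 a b; rewrite !scale1r.
rewrite act_dirXM actZr -!actM -!exprS -addrA -scalerDl; congr (_ + _ *: _).
by rewrite -[k.+2]addn1 natrD mulrDl mul1r addrC.
Qed.

(** Truncated, since the full series makes sense only on a given polynomial or modulo its
    annihilator, where [dir u] is nilpotent. *)
Definition exp_dir u K : DiffQ L := \sum_(k < K) (k`!%:R)^-1 *: dir u ^+ k.

Lemma exp_dirS u K h :
  diff_act L (exp_dir u K.+1) h =
    diff_act L (exp_dir u K) h + (K`!%:R)^-1 *: diff_act L (dir u ^+ K) h.
Proof. by rewrite /exp_dir !act_suml big_ord_recr actZl. Qed.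

Lemma exp_dir0 u h : diff_act L (exp_dir u 0) h = 0.
Proof. by rewrite /exp_dir big_ord0 act0l. Qed.

(** The commutator with ['X_i] differentiates the truncated series, which costs one term: hence
    [K.+1] on one side and [K] on the other. *)
Lemma exp_dirXM u (i : 'I_(lrank L)) h K :
  diff_act L (exp_dir u K.+1) ('X_i * h) =
    'X_i * diff_act L (exp_dir u K.+1) h + qcoord u i *: diff_act L (exp_dir u K) h.
Proof.
elim: K => [|K IH].
  by rewrite !exp_dirS !exp_dir0 !add0r scaler0 addr0 -scalerAr !act1.
rewrite exp_dirS IH act_dir_expXM [in RHS]exp_dirS (exp_dirS u K) !scalerDr !mulrDr.
rewrite addrACA !scalerA; congr (_ + _ + (_ + _ *: _)).
  by rewrite scalerAr.
by rewrite mulrA inv_factSr [RHS]mulrC.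
Qed.

(** Builds monomials one variable at a time, the form in which Taylor's formula and the finite-rank
    factorization of f(u + w) propagate. *)
Lemma Pol_ind (P : Pol L -> Prop) :
  P 1 -> (forall c h k, P h -> P k -> P (c *: h + k)) ->
  (forall i h, P h -> P ('X_i * h)) -> forall h, P h.
Proof.
move=> P1 PD PX; elim/mpolyind => [|c m h _ _ Ph].
  by rewrite -(addNr (1 : Pol L)) -scaleN1r; exact: PD.
apply: PD => //; rewrite mpolyXE_id -[X in P X]mulr1.
pose Q (q : Pol L) := forall k, P k -> P (q * k).
apply: (big_ind Q) (1 : Pol L) P1 => [k|q r Pq Pr k Pk|i _].
- by rewrite mul1r.
- by rewrite -mulrA; apply/Pq/Pr.
- elim: (m i) => [|n IH] k Pk; first by rewrite mul1r.
  by rewrite exprS -mulrA; apply/PX/IH.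
Qed.

Lemma exp_dir_shift u h :
  exists N, forall K, (N <= K)%N -> diff_act L (exp_dir u K) h = shift u h.
Proof.
elim/Pol_ind: h => [|c h k [N hN] [M kM]|i h [N hN]].
- exists 1%N; elim=> // -[_ _|K IH _].
    rewrite exp_dirS exp_dir0 add0r expr0 act1 invr1 scale1r.
    by rewrite /shift comp_mpoly1.
  rewrite exp_dirS IH // exprSr actM [X in diff_act L _ X]act_dir big1.
    by rewrite act0r scaler0 addr0.
  by move=> i _; rewrite -mpolyC1 mderivC scaler0.
- exists (maxn N M) => K; rewrite geq_max => /andP[NK MK].
  by rewrite (act_linr (diff_act L)) hN // kM // linearP.
- exists N.+1 => -[//|K] NK; rewrite exp_dirXM !hN ?(ltnW NK) //.
  rewrite /shift rmorphM /= comp_mpolyXU -tnth_nth tnth_mktuple mulrDl.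
  by rewrite mul_mpolyC.
Qed.

(** Consecutive partial sums of the exponential eventually both equal [shift u h], so their
    difference, a nonzero multiple of the power of [dir u] on [h], vanishes. *)
Lemma dir_exp_nilp u h : exists N, forall K, (N <= K)%N -> diff_act L (dir u ^+ K) h = 0.
Proof.
have [N hN] := exp_dir_shift u h; exists N => K NK; have := hN K.+1 (leqW NK).
rewrite exp_dirS hN // -[RHS]addr0 => /addrI /eqP; rewrite scaler_eq0 invr_eq0.
by rewrite pnatr_eq0 eqn0Ngt fact_gt0 => /eqP.
Qed.

Lemma nexp_cls_dir u (g : Pol L) :
  exists N, forall K, (N <= K)%N ->
    nexp (cls (diff_act L) g (dir u)) = cls (diff_act L) g (exp_dir u K).
Proof.
have [N gN] := dir_exp_nilp u g; exists N => K NK.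
rewrite (@nexpE _ _ _ _ _ K); last first.
  by apply: cact_inj; rewrite -rmorphXn cact_cls gN // linear0.
by rewrite /exp_dir [RHS]raddf_sum; apply: eq_bigr => k _; rewrite -rmorphXn -linearZ.
Qed.
End Taylor.

(** * The Chern character on orbits *)

Lemma ch_op_linear (L : lattice) (g : Pol L) : linear (ch_op g).
Proof. exact: fglift_is_linear. Qed.

Section ChernCharacter.
Variables (L : lattice) (f g : Pol L) (td : QA g).
Hypothesis f_td : f = cact td.

(** By linearity [a] may be taken to be T^u; its image is the class of a truncated exponential,
    which commutes past [td], and Taylor's formula applies to f = td . g. *)
Lemma cact_td_ch_op (a : Sh rat L) : cact (td * ch_op g a) = sh_act L a f.
Proof.
pose lhs (b : Sh rat L) := cact (td * ch_op g b).
suff : lhs a = sh_act L a f by [].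
elim/freeg_ind_dom0: a => [|q u a _ _ IH].
  by rewrite /lhs /ch_op raddf0 mulr0 linear0 act0l.
have -> : lhs (<< q *g u >> + a) = q *: lhs << u >> + lhs a.
  apply: etrans (cact_linear q _ _); rewrite /lhs (freegUE q) ch_op_linear mulrDr.
  by congr (cact (_ + _)); rewrite mulrC cyc_scaleAl mulrC.
rewrite IH (freegUE q); apply: etrans _ (esym (act_linl (sh_act L) f q << u >> a)).
congr (_ *: _ + _).
(* One truncation order must serve both [nexp] modulo Ann(g) and Taylor's formula on [f]. *)
have [N gN] := nexp_cls_dir u g; have [M fM] := exp_dir_shift u f.
rewrite /lhs /ch_op liftU scale1r (gN (maxn N M)) ?leq_maxl //.
rewrite cact_mul_cls -f_td fM ?leq_maxr //.
by rewrite /= /sh_act_fun liftU scale1r.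
Qed.

Lemma cact_td_ch (xi : QK f) : cact (td * ch g xi) = cact xi.
Proof. exact: cact_td_ch_op. Qed.
End ChernCharacter.

(** * Linear algebra of finite-rank infinite matrices *)

Section FiniteRank.
Variable F : fieldType.

(** Adding a point outside the current row span raises the rank, which is at most [N]. *)
Lemma spanning_points (X : Type) (N : nat) (p : X -> 'rV[F]_N) :
  exists (s : nat) (u : 'I_s -> X), forall x, (p x <= \matrix_i p (u i))%MS.
Proof.
suff step k : exists (s : nat) (u : 'I_s -> X),
    (forall x, (p x <= \matrix_i p (u i))%MS) \/ (k <= \rank (\matrix_i p (u i)))%N.
  by have [s [u [|]]] := step N.+1; [exists s, u | rewrite leqNgt ltnS rank_leq_col].
elim: k => [|k [s [u []]]]; first
  by exists 0%N, (fun i : 'I_0 => False_rect X (notF (ltn_ord i))); right.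
  by exists s, u; left.
move=> ku; have [all_u|/not_all_ex_not[x xu]] :=
  classic (forall x, (p x <= \matrix_i p (u i))%MS); first by exists s, u; left.
pose u' (i : 'I_(1 + s)) := if split i is inr j then u j else x.
exists (1 + s)%N, u'; right; apply: leq_ltn_trans ku _; apply: rank_ltmx.
rewrite ltmxE; apply/andP; split.
  apply/row_subP => j; apply: (@eq_row_sub _ _ _ _ _ (rshift 1 j)).
  by rewrite !rowK /u' (unsplitK (inr j)).
apply/negP => sub; apply: xu; apply: submx_trans sub.
apply: (@eq_row_sub _ _ _ _ _ (lshift s ord0)).
by rewrite rowK /u' (unsplitK (inl ord0)).
Qed.

Lemma column_combination (X Y : Type) (M : X -> Y -> F) (h : X -> F) (N : nat)
    (p : X -> 'rV[F]_N) (q : Y -> 'cV[F]_N) :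
  (forall x y, M x y = (p x *m q y) 0 0) ->
  (forall (s : nat) (c : 'I_s -> F) (x : 'I_s -> X),
     (forall y, \sum_i c i * M (x i) y = 0) -> \sum_i c i * h (x i) = 0) ->
  exists (t : nat) (b : 'I_t -> F) (y : 'I_t -> Y),
    forall x, h x = \sum_j b j * M x (y j).
Proof.
move=> Mpq hM.
have [s [x spanx]] := spanning_points p.
have [t [y spany]] := spanning_points (fun y => (q y)^T).
set P := \matrix_i p (x i) in spanx; set Q := \matrix_i _ in spany.
have hsum c : (forall y', (c *m P *m q y') 0 0 = 0) -> \sum_i c 0 i * h (x i) = 0.
  move=> cPq; apply: hM => y'; rewrite -[RHS](cPq y') -mulmxA mxE; apply: eq_bigr => i _.
  by rewrite Mpq !mxE; congr (_ * _); apply: eq_bigr => k _; rewrite !mxE.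
pose H := \col_i h (x i).
have HE c : (c *m H) 0 0 = \sum_i c 0 i * h (x i).
  by rewrite mxE; apply: eq_bigr => i _; rewrite mxE.
(* It suffices that every relation among the rows of [P *m Q^T] kills [H]. As the [q (y j)] span,
   such a relation holds in every column of [M], so [hM] applies. *)
have /submxP[b Hb] : (H^T <= (P *m Q^T)^T)%MS.
  rewrite submxE; apply/eqP/matrixP => i j; rewrite (ord1 i) [RHS]mxE.
  move: (cokermx _) (mulmx_coker (P *m Q^T)^T) => K /(congr1 trmx).
  rewrite trmx_mul trmxK trmx0 => KPQ.
  have -> : (H^T *m K) 0 j = (row j K^T *m H) 0 0.
    by rewrite -row_mul [RHS]mxE -[K^T *m H]trmxK trmx_mul trmxK [RHS]mxE.
  rewrite HE; apply: hsum => y'; have /submxP[d qd] := spany y'.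
  rewrite -[q y']trmxK qd trmx_mul !mulmxA -(mulmxA _ P) -row_mul KPQ.
  by rewrite row0 mul0mx mxE.
exists t, (fun j => b 0 j), y => x'.
have /submxP[c pc] := spanx x'.
(* The relation expressing row [x'] through the rows [x i], with the new point at index 0; by [hM]
   it carries over to [h]. *)
pose k (i : 'I_s.+1) := if unlift ord0 i is Some j then - c 0 j else 1.
pose z (i : 'I_s.+1) := if unlift ord0 i is Some j then x j else x'.
have hx' : h x' = (c *m H) 0 0.
  have sumE (G : X -> F) : \sum_i k i * G (z i) = G x' - \sum_i c 0 i * G (x i).
    rewrite big_ord_recl /k /z unlift_none mul1r -sumrN; congr (_ + _).
    by apply: eq_bigr => i _; rewrite liftK mulNr.
  apply/eqP; rewrite HE -subr_eq0 -sumE; apply/eqP/hM => y'.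
  rewrite (sumE (M^~ y')) Mpq pc -mulmxA mxE; apply/eqP; rewrite subr_eq0; apply/eqP.
  apply: eq_bigr => i _; have <- : (P *m q y') i 0 = M (x i) y' => //.
  by rewrite Mpq -(rowK (fun j => p (x j))) -row_mul [RHS]mxE.
have HPQ : H = P *m (Q^T *m b^T).
  by apply: trmx_inj; rewrite Hb mulmxA [in RHS]trmx_mul trmxK.
rewrite hx' HPQ mulmxA -pc mulmxA mxE; apply: eq_bigr => j _.
rewrite Mpq [b^T _ _]mxE mulrC; congr (_ * _); rewrite !mxE.
by apply: eq_bigr => i _; rewrite !mxE.
Qed.
End FiniteRank.

(** * Polynomials killed by Ann(f) lie in Sh . f *)

Section DoubleAnnihilator.
Variable L : lattice.
Implicit Types (f h : Pol L) (a b : Sh rat L).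

Lemma sh_actU (u : L) h : sh_act L << u >> h = shift u h.
Proof. by rewrite /= /sh_act_fun liftU scale1r. Qed.

Lemma peval_sh_act (s : nat) (c : 'I_s -> rat) (x : 'I_s -> L) h (y : L) :
  peval (sh_act L (\sum_i c i *: << x i >>) h) y = \sum_i c i * peval h (y + x i).
Proof.
rewrite act_suml /peval raddf_sum; apply: eq_bigr => i _.
by rewrite actZl sh_actU [LHS]mevalZ; congr (_ * _); apply: peval_shift.
Qed.

(** Multiplying by ['X_i] multiplies f(u + w) by the sum of the i-th coordinates of u and w, which
    doubles the inner dimension. *)
Lemma peval_add_finite_rank f :
  exists (N : nat) (p : L -> 'rV[rat]_N) (q : L -> 'cV[rat]_N),
    forall u w, peval f (u + w) = (p u *m q w) 0 0.
Proof.
elim/Pol_ind: f => [|c f h [N [p [q pq]]] [N' [p' [q' pq']]]|i f [N [p [q pq]]]].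
- exists 1%N, (fun=> 1%:M), (fun=> 1%:M) => u w.
  by rewrite /peval meval1 mul1mx mxE.
- exists (N + N')%N, (fun u => row_mx (c *: p u) (p' u)), (fun w => col_mx (q w) (q' w)).
  move=> u w; rewrite mul_row_col -scalemxAl {1}/peval mevalD mevalZ.
  by rewrite -!/(peval _ _) pq pq' !mxE.
- exists (N + N)%N, (fun u => row_mx (qcoord u i *: p u) (p u)).
  exists (fun w => col_mx (q w) (qcoord w i *: q w)) => u w.
  rewrite mul_row_col -scalemxAl -scalemxAr -scalerDl mxE -pq -qcoordD.
  by rewrite /peval mevalM mevalXU.
Qed.

Lemma sub_ann_orbit f h :
  (forall a, sh_act L a f = 0 -> sh_act L a h = 0) -> exists b, h = sh_act L b f.
Proof.
move=> fh; have [N [p [q pq]]] := peval_add_finite_rank f.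
have [|t [b [y hE]]] := @column_combination _ _ _ _ (peval h) _ _ _ pq.
  (* A relation among rows is an operator [a] killing [f], hence [h]; evaluating at 0 gives the
     relation for the values of [h]. *)
  move=> s c x cx; pose a : Sh rat L := \sum_i c i *: << x i >>.
  have /fh/(congr1 (fun k : Pol L => peval k 0)) : sh_act L a f = 0.
    apply: peval_inj => y; rewrite peval_sh_act [RHS]meval0 -[RHS](cx y).
    by apply: eq_bigr => i _; rewrite addrC.
  rewrite peval_sh_act [peval 0 0]meval0 => h0; rewrite -[RHS]h0.
  by apply: eq_bigr => i _; rewrite add0r.
exists (\sum_j b j *: << y j >>).
by apply: peval_inj => x; rewrite peval_sh_act hE.
Qed.
End DoubleAnnihilator.

(** * Existence of the pullbacks and the commuting diagram *)

Section PullbackExistence.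
Variables (L1 L2 : lattice) (phi : {additive L1 -> L2}).

Lemma shift_pull (u : L1) (h : Pol L2) :
  shift u (pull phi h) = pull phi (shift (phi u) h).
Proof.
by apply: peval_inj => x; rewrite peval_shift !peval_pull peval_shift raddfD.
Qed.

Lemma pull_linear : linear (pull phi).
Proof.
move=> c h k; apply: peval_inj => x.
by rewrite peval_pull /peval !(mevalD, mevalZ) -!/(peval _ _) !peval_pull.
Qed.

Lemma sh_rat_act_linear (L : lattice) (h : Pol L) (k : int) (u : L) (a : Sh int L) :
  sh_act L (sh_rat (k *: << u >> + a)) h
    = k%:~R *: shift u h + sh_act L (sh_rat a) h.
Proof.
have U : sh_rat (<< u >> : Sh int L) = << u >>.
  by apply/eqP/freeg_eqP => w; rewrite coeff_sh_rat !coeffU !mul1r rmorph_nat.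
rewrite sh_ratD sh_ratZ U -sh_actU; exact: (act_linl (sh_act L) h).
Qed.

Lemma act_pull (b : Sh int L1) (h : Pol L2) :
  sh_act L1 (sh_rat b) (pull phi h) = pull phi (sh_act L2 (sh_rat (push phi b)) h).
Proof.
have sh_rat0 (L : lattice) : sh_rat (0 : Sh int L) = 0.
  by apply/eqP/freeg_eqP => w; rewrite coeff_sh_rat !coeff0.
have pull0 : pull phi 0 = 0 by rewrite /pull comp_mpoly0.
elim/freeg_ind_dom0: b => [|k u b _ _ IH].
  by rewrite /push raddf0 !sh_rat0 !act0l pull0.
have -> : push phi (<< k *g u >> + b) = k *: << phi u >> + push phi b.
  by rewrite /push raddfD /= liftU.
by rewrite (freegUE k) !sh_rat_act_linear IH shift_pull pull_linear.
Qed.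

Lemma pull_orbit (f1 : Pol L1) (f2 : Pol L2) :
  (forall a : Sh int L1, a \in annSh f1 -> push phi a \in annSh f2) ->
  forall a : Sh rat L2, exists b : Sh rat L1, pull phi (sh_act L2 a f2) = sh_act L1 b f1.
Proof.
move=> f12 a; apply: sub_ann_orbit => b b0.
(* The hypothesis concerns integral operators, so denominators of [b] are cleared first. *)
have /annSh_rat[m [b' [m0 /f12/eqP b'0 mb]]] : b \in ann (sh_act L1) f1 by apply/eqP.
apply/eqP; suff : m%:R *: sh_act L1 b (pull phi (sh_act L2 a f2)) == 0.
  by rewrite scaler_eq0 pnatr_eq0 eqn0Ngt m0.
by rewrite -actZl mb act_pull actC b'0 act0r /pull comp_mpoly0.
Qed.

(** [eta] witnesses that the choice in [cyc_pull] is satisfiable, and [cact_inj] makes the solution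
    unique. *)
Lemma cyc_pull_eq (R1 R2 : comAlgType rat) (A1 : action R1 (Pol L1))
    (A2 : action R2 (Pol L2)) (v1 : Pol L1) (v2 : Pol L2) (xi : cyc A2 v2) (eta : cyc A1 v1) :
  cact eta = pull phi (cact xi) -> cyc_pull phi A1 v1 xi = eta.
Proof.
move=> e; apply: cact_inj; rewrite e /cyc_pull.
by apply: (epsilon_spec (inhabits 0) (fun z => cact z = pull phi (cact xi))); exists eta.
Qed.
End PullbackExistence.

Theorem theorem3p16 (L1 L2 : lattice) (phi : {additive L1 -> L2})
    (f1 g1 : Pol L1) (td1 : QA g1) (f2 g2 : Pol L2) (td2 : QA g2) :
  RR_pair f1 td1 -> RR_pair f2 td2 ->
  (forall a : Sh int L1, a \in annSh f1 -> push phi a \in annSh f2) ->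
  forall xi : QK f2,
    pullA phi g1 (td2 * ch g2 xi) = td1 * ch g1 (pullK phi f1 xi).
Proof.
move=> [_ _ f1td] [_ _ f2td] f12 xi.
have [b pull_xi] := pull_orbit f12 (rep xi).
have cls_b : cact (cls (sh_act L1) f1 b) = pull phi (cact xi).
  by rewrite cact_cls -pull_xi.
(* With [pullK] identified as the class of [b], it remains to compare actions on [g1]: both are the
   pullback of xi . f2. *)
rewrite /pullK (cyc_pull_eq cls_b); apply: cyc_pull_eq.
by rewrite (cact_td_ch f1td) (cact_td_ch f2td).
Qed.
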